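(* Let $G$ be a finite simple graph of order $n$ with no connected component of order less than $3$, such that every bipartite connected component of $G$ has both color classes of even order. Then $s_g(G)=n$ if $n\equiv 1 \pmod 2$; $s_g(G)=n+1$ if $n\equiv 2\pmod 4$; and $s_g(G)\leq n+1$ if $n\equiv 0\pmod 4$.
   Context: For an Abelian group $\mathcal{G}$ (written additively) and an edge labeling $f:E(G)\rightarrow\mathcal{G}$, the weighted degree of a vertex $v$ is $w(v)=\sum_{u\in N(v)} f(uv)$ (sum in $\mathcal{G}$). The labeling $f$ is called $\mathcal{G}$-irregular if all weighted degrees are pairwise distinct. The group irregularity strength $s_g(G)$ is the smallest integer $s$ such that for every Abelian group $\mathcal{G}$ of order $s$ there exists a $\mathcal{G}$-irregular labeling of $G$. The color classes of a bipartite connected component are the two parts of its (unique) bipartition. *)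

(* Defs.v *)
From mathcomp Require Import all_boot all_algebra.
Set Implicit Arguments.
Unset Strict Implicit.
Unset Printing Implicit Defensive.
Import GRing.Theory.

(* A finite simple graph is a symmetric irreflexive relation e on a finType. *)

Definition components (T : finType) (e : rel T) : {set {set T}} :=
  equivalence_partition (connect e) [set: T].

Definition independent (T : finType) (e : rel T) (X : {set T}) : Prop :=
  {in X &, forall x y, ~~ e x y}.

Definition color_classes (T : finType) (e : rel T) (C X Y : {set T}) : Prop :=
  [/\ X :|: Y = C, [disjoint X & Y], independent e X & independent e Y].

(* The edge uv is the unordered pair [set u; v]; a labeling is given as a
   function on all sets of vertices, but only its values on edges matter. *)
Definition weighted_degree (T : finType) (e : rel T) (A : zmodType)
    (f : {set T} -> A) (v : T) : A :=
  (\sum_(u | e v u) f [set u; v])%R.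

Definition group_irregular (T : finType) (e : rel T) (A : zmodType)
    (f : {set T} -> A) : Prop :=
  injective (weighted_degree e f).

(* No group has order 0, so 0 < s is needed to exclude the vacuous case. *)
Definition irregular_order (T : finType) (e : rel T) (s : nat) : Prop :=
  0 < s /\
  forall A : finZmodType, #|A| = s ->
    exists f : {set T} -> A, group_irregular e f.

(* s_g(G) = s, as a relation: s is the least element of irregular_order e. *)
Definition is_group_irregularity_strength (T : finType) (e : rel T)
    (s : nat) : Prop :=
  irregular_order e s /\ forall t : nat, irregular_order e t -> s <= t.

(* Main.v *)
Require Import Defs.
From HB Require Import structures.
From mathcomp Require Import all_boot all_algebra.
From mathcomp Require Import zify.
From Stdlib Require Import Classical_Prop.

(** The weight functions realised by edge labelings form a group.  Labeling the
    edges of a walk from [x] to [y] alternately by [a] and [-a] realises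
    [a] at [x] and [-a] or [a] at [y], according to whether the length of the
    walk is even or odd.  In a group of odd order, where [2] is invertible, this
    gives every value at a single vertex lying on an odd closed walk, and the
    pair of values [a], [-a] at two vertices in the same color class of a
    bipartite component.  Since these classes are even, their vertices can be
    matched within each class and the matched pairs labelled by distinct pairs
    of opposite nonzero elements; all other vertices take the remaining
    elements in any order.  For [n = 2 %[mod 4]] the group of order [n] that
    fails is [Z_2 * Z_(n/2)]: the sum of all its elements is not the double of
    an element, while a sum of weighted degrees always is. *)

Set Implicit Arguments.
Unset Strict Implicit.
Unset Printing Implicit Defensive.
Import GRing.Theory.
Local Open Scope ring_scope.

(** Makes products of finite groups available as a [finZmodType], for the counterexample
    ['I_2 * 'I_m.+1]. *)
HB.instance Definition _ (U V : finZmodType) := GRing.Zmodule.on (U * V)%type.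

(** * Realisable weights *)

Section Realisable.
Variables (T : finType) (e : rel T).
Hypotheses (e_sym : symmetric e) (e_irrefl : irreflexive e).

Definition realisable (A : zmodType) (w : T -> A) : Prop :=
  exists f : {set T} -> A, weighted_degree e f =1 w.

Definition delta (A : zmodType) (x : T) (a : A) (v : T) : A :=
  if v == x then a else 0.

(* Vertices of the bipartite double cover record the parity of a walk. *)
Definition double_cover : rel (T * bool) :=
  [rel p q | e p.1 q.1 && (p.2 != q.2)].

Definition even_walk (x y : T) : bool :=
  connect double_cover (x, false) (y, false).

Definition odd_walk (x y : T) : bool :=
  connect double_cover (x, false) (y, true).

Section Labelings.
Variable A : zmodType.
Implicit Types w : T -> A.

Lemma eq_realisable w1 w2 : w1 =1 w2 -> realisable w1 -> realisable w2.
Proof. by move=> E [f Hf]; exists f => v; rewrite Hf E. Qed.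

Lemma realisable0 : realisable (fun _ => 0 : A).
Proof. by exists (fun _ => 0) => v; rewrite /weighted_degree big1. Qed.

Lemma realisableD w1 w2 :
  realisable w1 -> realisable w2 -> realisable (fun v => w1 v + w2 v).
Proof.
move=> [f Hf] [g Hg]; exists (fun E => f E + g E) => v.
by rewrite -Hf -Hg /weighted_degree big_split.
Qed.

Lemma realisable_sum (S : {set T}) (F : T -> T -> A) :
  {in S, forall x, realisable (F x)} ->
  realisable (fun v => \sum_(x in S) F x v).
Proof.
move=> HF.
have {HF}: forall x, x \in enum S -> realisable (F x).
  by move=> x; rewrite mem_enum; apply: HF.
move=> H.
suff: realisable (fun v => \sum_(x <- enum S) F x v).
  by apply: eq_realisable => v; rewrite big_enum.
elim: (enum S) H => [|x s IH] H.
  by apply: eq_realisable realisable0 => v; rewrite big_nil.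
apply: eq_realisable (realisableD (H x (mem_head _ _)) (IH _)).
  by move=> v; rewrite big_cons.
by move=> y ys; apply: H; rewrite in_cons ys orbT.
Qed.

Lemma realisable_edge (u v : T) (a : A) :
  e u v -> realisable (fun z => delta u a z + delta v a z).
Proof.
move=> euv; have uv : u != v by apply: contraTneq euv => ->; rewrite e_irrefl.
exists (fun E => if E == [set u; v] then a else 0) => z.
rewrite /weighted_degree /delta.
have [->|zu] := eqVneq z u.
  rewrite (negbTE uv) addr0 (bigD1 v) //= setUC eqxx big1 ?addr0 // => y.
  move=> /andP[_ yv]; case: eqP => // /setP/(_ v).
  by rewrite !inE eqxx orbT eq_sym (negbTE yv) eq_sym (negbTE uv).
have [->|zv] := eqVneq z v.
  rewrite add0r (bigD1 u) 1?e_sym //= eqxx big1 ?addr0 // => y.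
  move=> /andP[_ yu]; case: eqP => // /setP/(_ u).
  by rewrite !inE eqxx eq_sym (negbTE yu) (negbTE uv).
rewrite add0r big1 // => y _; case: eqP => // /setP/(_ z).
by rewrite !inE eqxx orbT (negbTE zu) (negbTE zv).
Qed.

Lemma realisable_walk (p q : T * bool) (a : A) :
  connect double_cover p q ->
  realisable (fun z => delta p.1 a z
                       + delta q.1 (if p.2 == q.2 then - a else a) z).
Proof.
case/connectP=> s; elim/last_ind: s q => [|s r IH] q.
  move=> _ -> /=; rewrite eqxx; apply: eq_realisable realisable0 => z.
  by rewrite /delta; case: eqP; rewrite ?subrr ?addr0.
rewrite rcons_path last_rcons => /andP[ps es] ->.
have {}IH := IH _ ps (erefl _); case/andP: es => /= es ns.
(* The label [c] of the appended edge is the opposite of what the walk so far leaves at its last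
   vertex, so the two cancel there. *)
pose c := if p.2 == (last p s).2 then a else - a.
apply: eq_realisable (realisableD IH (realisable_edge c es)) => z.
rewrite addrA -(addrA (delta p.1 a z)); congr (_ + _).
  rewrite -[RHS]addr0; congr (_ + _).
  rewrite /delta /c; case: (z == _); last by rewrite addr0.
  by case: (p.2 == _); rewrite ?addNr ?subrr.
congr (delta _ _ z); rewrite /c.
by case: (p.2) (last p s).2 r.2 ns => [] [] [].
Qed.

End Labelings.

(** * Color classes as classes of even walks *)

Lemma double_cover_sym : connect_sym double_cover.
Proof. by apply: sym_connect_sym => p q; rewrite /double_cover /= e_sym eq_sym. Qed.

(** Exchanging the two sheets is an automorphism of the double cover. *)
Lemma connect_double_cover_flip (p q : T * bool) :
  connect double_cover p q ->
  connect double_cover (p.1, ~~ p.2) (q.1, ~~ q.2).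
Proof.
case/connectP=> s; elim: s p => [|r s IH] p /=; first by move=> _ ->.
case/andP=> /andP[er nr] ps lq; apply: connect_trans (IH _ ps lq).
by apply: connect1; rewrite /double_cover /= er; case: (p.2) (r.2) nr => [] [].
Qed.

Lemma connect_double_coverE (p q : T * bool) :
  connect double_cover p q -> connect e p.1 q.1.
Proof.
case/connectP=> s; elim: s p => [|r s IH] p /=; first by move=> _ ->.
by case/andP=> /andP[er _] ps lq; apply: connect_trans (connect1 er) (IH _ ps lq).
Qed.

Lemma connect_walk (x y : T) : connect e x y -> even_walk x y || odd_walk x y.
Proof.
case/connectP=> s; elim/last_ind: s y => [|s r IH] y.
  by move=> _ ->; rewrite /even_walk connect0.
rewrite rcons_path last_rcons => /andP[ps es] ->.
case/orP: (IH _ ps (erefl _)) => H; apply/orP; [right|left];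
  by apply: connect_trans H (connect1 _); rewrite /double_cover /= es.
Qed.

Lemma even_walk_refl : reflexive even_walk.
Proof. by move=> x; apply: connect0. Qed.

Lemma even_walk_sym : symmetric even_walk.
Proof. by move=> x y; apply: double_cover_sym. Qed.

Lemma even_walk_trans : transitive even_walk.
Proof. by move=> y x z; apply: connect_trans. Qed.

(** The odd walk to [y] is closed up by the reverse of the even one, lifted to the other sheet. *)
Lemma even_odd_walk (x y : T) : even_walk x y -> odd_walk x y -> odd_walk x x.
Proof.
move=> xy xy'; apply: connect_trans xy' _.
by rewrite double_cover_sym; apply: connect_double_cover_flip xy.
Qed.

(** An edge within either set would give its end a walk from [x] of each parity, hence an odd closed
    walk at [x]. *)
Lemma even_walk_color_class (x : T) : ~~ odd_walk x x ->
  color_classes e [set y | connect e x y]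
    [set y | even_walk x y] [set y | odd_walk x y].
Proof.
move=> nx; have no y : even_walk x y -> odd_walk x y -> False.
  by move=> H /(even_odd_walk H); apply/negP.
split.
- apply/setP=> y; rewrite !inE; apply/idP/idP; last exact: connect_walk.
  by case/orP => /connect_double_coverE.
- rewrite -setI_eq0; apply/eqP/setP=> y; rewrite !inE.
  by apply/negP=> /andP[]; apply: no.
- move=> u v; rewrite !inE => xu xv; apply/negP=> uv; apply: (no v) => //.
  by apply: connect_trans xu (connect1 _); rewrite /double_cover /= uv.
- move=> u v; rewrite !inE => xu xv; apply/negP=> uv; apply: (no v) => //.
  by apply: connect_trans xu (connect1 _); rewrite /double_cover /= uv.
Qed.

(** * Injective realisable weights *)

Section OddGroup.
Variable A : finZmodType.
Hypothesis odd_A : odd #|A|.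

(** Translation by [a] permutes the group, so it leaves the sum of all elements unchanged. *)
Lemma mulrn_card (a : A) : a *+ #|A| = 0.
Proof.
apply: (addrI (\sum_(x : A) x)); rewrite addr0.
rewrite [RHS](reindex_inj (addIr a)) big_split /= sumr_const.
by rewrite cardE -cardT.
Qed.

Lemma half_of (a : A) : exists b : A, b + b = a.
Proof.
exists (a *+ (#|A|.+1)./2); rewrite -mulrnDr addnn.
have -> : (#|A|.+1)./2.*2 = #|A|.+1.
  by have := odd_double_half #|A|.+1; rewrite /= odd_A.
by rewrite mulrS mulrn_card addr0.
Qed.

Lemma neq_opp (a : A) : a != 0 -> a != - a.
Proof.
apply: contraNneq => aNa; have a2 : a *+ 2 = 0 by rewrite mulr2n {1}aNa addNr.
have := mulrn_card a; rewrite -(odd_double_half #|A|) odd_A -mul2n.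
by rewrite mulrnDr mulrnA a2 mul0rn addr0 mulr1n => ->.
Qed.

(** Both ends of the closed walk are [x], which receives its label twice; half of [a] is therefore
    used. *)
Lemma realisable_odd_walk (x : T) (a : A) :
  odd_walk x x -> realisable (delta x a).
Proof.
have [b <-] := half_of a => /(realisable_walk b).
by apply: eq_realisable => z; rewrite /= /delta; case: eqP; rewrite ?addr0.
Qed.

(** The sets [S] and [D] are those of vertices still to be served and of values still free.
    Induction on [#|S|] removes two vertices of one class together with two opposite values, which
    preserves all three hypotheses. *)
Lemma injective_realisable_on (S : {set T}) (D : {set A}) :
  {in S, forall x, ~~ odd_walk x x -> ~~ odd #|[set y in S | even_walk x y]|} ->
  {in D, forall a, - a \in D} -> (#|S| <= #|D|)%N ->
  exists w : T -> A, [/\ {in S &, injective w}, {in S, forall x, w x \in D}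
    & realisable (fun v => if v \in S then w v else 0)].
Proof.
have [k] := ubnP #|S|; elim: k S D => // k IH S D Sk evS oppD SD.
have [|allodd] := boolP [exists x in S, ~~ odd_walk x x]; last first.
  have wD x : x \in S -> (index x (enum S) < size (enum D))%N.
    move=> xS; rewrite -cardE; apply: leq_trans SD.
    by rewrite cardE index_mem mem_enum.
  (* By [wD] the default [0] is never reached on [S]. *)
  pose w v := nth 0 (enum D) (index v (enum S)); exists w; split.
  - move=> x y xS yS /eqP; rewrite nth_uniq ?enum_uniq ?wD // => /eqP.
    by apply: index_inj; rewrite ?mem_enum.
  - by move=> x xS; rewrite -mem_enum mem_nth ?wD.
  - apply: (@eq_realisable _ (fun v => \sum_(x in S) delta x (w x) v)).
      move=> v; rewrite /delta; have [vS|vS] := boolP (v \in S).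
        rewrite (bigD1 v) //= eqxx big1 ?addr0 // => x /andP[_].
        by rewrite eq_sym => /negbTE->.
      by rewrite big1 // => x xS; case: eqP => // vx; rewrite vx xS in vS.
    apply: realisable_sum => x xS; apply: realisable_odd_walk.
    by apply: contraNT allodd => nx; apply/existsP; exists x; rewrite xS.
case/existsP=> x /andP[xS nx].
have [y /andP[yx yS] xy] : exists2 y, (y != x) && (y \in S) & even_walk x y.
  have := evS x xS nx.
  rewrite (cardsD1 x) !inE xS even_walk_refl /= negbK => /odd_gt0/card_gt0P[y].
  by rewrite !inE => /andP[yx /andP[yS xy]]; exists y; rewrite ?yx.
have xyS : [set x; y] \subset S by rewrite subUset !sub1set xS.
have S2 : (1 < #|S|)%N by have := subset_leq_card xyS; rewrite cards2 eq_sym yx.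
have [a /andP[a0 aD]] : exists a, (a != 0) && (a \in D).
  have /card_gt0P[a] : (0 < #|D :\ 0%R|)%N.
    move: (leq_trans S2 SD); rewrite (cardsD1 0).
    by case: (0 \in D) => // /ltnW.
  by rewrite !inE; exists a.
have aNa := neq_opp a0.
have aaD : [set a; - a] \subset D by rewrite subUset !sub1set aD oppD.
pose S' := S :\: [set x; y]; pose D' := D :\: [set a; - a].
have cS : #|S'| = (#|S| - 2)%N by rewrite cardsDS // cards2 eq_sym yx.
have cD : #|D'| = (#|D| - 2)%N by rewrite cardsDS // cards2 aNa.
have [||||w [injw wD rw]] := IH S' D'.
- by rewrite cS; move: #|S| Sk S2 => m; clear; lia.
(* The class of [z] loses both [x] and [y] or neither, so its parity in [S'] is unchanged. *)
- move=> z; rewrite !inE negb_or => /andP[/andP[zx zy] zS] nz.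
  have := evS z zS nz.
  have -> : [set u in S' | even_walk z u]
            = [set u in S | even_walk z u] :\: [set x; y].
    by apply/setP=> u; rewrite !inE andbA.
  have [zx'|zx'] := boolP (even_walk z x).
    have sub : [set x; y] \subset [set u in S | even_walk z u].
      by rewrite subUset !sub1set !inE xS yS zx' (even_walk_trans zx' xy).
    rewrite cardsDS // oddB; last exact: subset_leq_card sub.
    by rewrite cards2 eq_sym yx addbF.
  rewrite (_ : _ :\: _ = [set u in S | even_walk z u]) //.
  apply/setP=> u; rewrite !inE; have [zu|] := boolP (even_walk z u);
    last by rewrite !andbF.
  rewrite !andbT; case: eqP => [ux|_] /=; first by rewrite -ux zu in zx'.
  case: eqP => [uy|_] //=; rewrite uy in zu.
  by rewrite (even_walk_trans zu) // even_walk_sym in zx'.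
- move=> b; rewrite !inE => /andP[ba bD]; rewrite oppD // andbT.
  by rewrite eqr_opp eqr_oppLR orbC.
- by rewrite cS cD leq_sub2r.
have wS' v : v \in S -> v != x -> v != y ->
    [/\ v \in S', w v \in D, w v != a & w v != - a].
  move=> vS vx vy; have vS' : v \in S' by rewrite !inE negb_or vx vy.
  by case/setDP: (wD v vS') => wvD; rewrite in_set2 => /norP[].
exists (fun v => if v == x then a else if v == y then - a else w v); split.
- move=> u v uS vS.
  have [->|ux] := eqVneq u x; have [->|vx] := eqVneq v x => //.
  + have [_ /eqP|vy E] := eqVneq v y; first by rewrite (negbTE aNa).
    by have [_ _] := wS' v vS vx vy; rewrite E eqxx.
  + have [_ /eqP|uy E] := eqVneq u y; first by rewrite eq_sym (negbTE aNa).
    by have [_ _] := wS' u uS ux uy; rewrite E eqxx.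
  have [->|uy] := eqVneq u y; have [->|vy] := eqVneq v y => // E.
  + by have [_ _ _] := wS' v vS vx vy; rewrite E eqxx.
  + by have [_ _ _] := wS' u uS ux uy; rewrite E eqxx.
  have [uS' _ _ _] := wS' u uS ux uy; have [vS' _ _ _] := wS' v vS vx vy.
  exact: injw.
- move=> v vS; have [_|vx] := eqVneq v x => //.
  by have [_|vy] := eqVneq v y; [exact: oppD | case: (wS' v vS vx vy)].
apply: eq_realisable (realisableD (realisable_walk a xy) rw) => v /=.
rewrite /delta !inE; have [->|vx] := eqVneq v x.
  by rewrite eq_sym (negbTE yx) xS /= !addr0.
have [->|vy] := eqVneq v y; first by rewrite yS /= add0r addr0.
by rewrite !add0r.
Qed.

End OddGroup.

(** * Lower bounds *)

Lemma sum_weighted_degree (A : zmodType) (f : {set T} -> A) :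
  exists a : A, \sum_v weighted_degree e f v = a *+ 2.
Proof.
pose F (v u : T) := f [set u; v].
(* Ordering vertices by [enum_rank] counts each edge once in [G]; the degree sum counts it from both
   ends. *)
pose G := \sum_(v : T) \sum_(u | e v u && (enum_rank v < enum_rank u)%N) F v u.
exists G; rewrite mulr2n {2}/G.
under [X in _ + X]eq_bigr do rewrite big_mkcond.
rewrite exchange_big -big_split /=; apply: eq_bigr => v _.
rewrite -big_mkcond /weighted_degree.
rewrite (bigID (fun u => enum_rank v < enum_rank u)%N) /=.
congr (_ + _); apply: eq_big => [u|u _]; last by rewrite /F setUC.
rewrite e_sym; have [euv|] //= := boolP (e u v).
rewrite -leqNgt leq_eqVlt; case: eqP => // /val_inj/enum_rank_inj E.
by rewrite E e_irrefl in euv.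
Qed.

Lemma irregular_order_ge (s : nat) : irregular_order e s -> (#|T| <= s)%N.
Proof.
case: s => [[] //|s] [_ /(_ 'I_s.+1 (card_ord _)) [f /leq_card]].
by rewrite card_ord.
Qed.

Lemma not_irregular_order_card : #|T| = 2 %[mod 4] -> ~ irregular_order e #|T|.
Proof.
move=> T2; have Tm : #|T| = (2 * (#|T| %/ 2).-1.+1)%N by lia.
have oddm : odd (#|T| %/ 2).-1.+1 by lia.
move: (#|T| %/ 2).-1 Tm oddm => m Tm oddm [_].
pose A : finZmodType := ('I_2 * 'I_m.+1)%type.
have cA : #|A| = #|T| by rewrite card_prod !card_ord.
case/(_ A cA) => f injf; have [a Ha] := sum_weighted_degree f.
(* As [#|A| = #|T|], the weighted degrees exhaust [A], and their sum is that of all elements. *)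
have bij : bijective (weighted_degree e f) by apply: inj_card_bij; rewrite ?cA.
have sumA : \sum_(b : A) b = a *+ 2.
  by rewrite -Ha; apply: reindex; apply: onW_bij.
have dbl (b : 'I_2) : b *+ 2 = 0 by apply: val_inj; case: b => [[|[]]].
have : (\sum_(b : A) b).1 = 0 by rewrite sumA; apply: dbl.
(* Each element of ['I_2] is the first component of [m.+1] pairs, an odd number, so the first
   component of the sum is [1]. *)
rewrite (raddf_sum fst) /= -(pair_bigA _ (fun i _ => i)) /=.
rewrite exchange_big sumr_const card_ord !big_ord_recl big_ord0 /=.
rewrite -(odd_double_half m.+1) oddm -mul2n.
by rewrite mulrnDr mulrnA dbl mul0rn addr0 => /(congr1 val).
Qed.

(** * Irregular labelings *)

Section Irregular.
Hypothesis even_classes : forall C X Y : {set T}, C \in components e ->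
  color_classes e C X Y -> ~~ odd #|X| /\ ~~ odd #|Y|.

Lemma even_walk_class_even (x : T) :
  ~~ odd_walk x x -> ~~ odd #|[set y | even_walk x y]|.
Proof.
move/even_walk_color_class/even_classes => H; apply: (H _).1.
by apply/imsetP; exists x => //; apply/setP=> y; rewrite !inE.
Qed.

Lemma odd_irregular_order (s : nat) :
  odd s -> (#|T| <= s)%N -> irregular_order e s.
Proof.
move=> odd_s Ts; split=> [|A cA]; first exact: odd_gt0.
have [||||w [injw _ [f Hf]]] := @injective_realisable_on A _ setT setT.
- by rewrite cA.
- move=> x _ /even_walk_class_even; congr (~~ odd _).
  by apply: eq_card => y; rewrite !inE.
- by move=> a _; rewrite inE.
- by rewrite !cardsT cA.
by exists f => u v; rewrite !Hf !inE; apply: injw.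
Qed.

End Irregular.
End Realisable.

Local Close Scope ring_scope.

Theorem theorem1p4 (T : finType) (e : rel T) (n : nat)
    (e_sym : symmetric e) (e_irrefl : irreflexive e)
    (order_n : #|T| = n)
    (comp_ge3 : forall C : {set T}, C \in components e -> 3 <= #|C|)
    (even_classes : forall C X Y : {set T}, C \in components e ->
       color_classes e C X Y -> ~~ odd #|X| /\ ~~ odd #|Y|) :
  [/\ n = 1 %[mod 2] -> is_group_irregularity_strength e n,
      n = 2 %[mod 4] -> is_group_irregularity_strength e n.+1
    & n = 0 %[mod 4] ->
      exists2 s : nat, is_group_irregularity_strength e s & s <= n.+1].
Proof.
subst n.
have up s : odd s -> #|T| <= s -> irregular_order e s.
  exact: odd_irregular_order.
have low s : irregular_order e s -> #|T| <= s by apply: irregular_order_ge.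
have low_succ : ~ irregular_order e #|T| ->
    forall s, irregular_order e s -> #|T|.+1 <= s.
  move=> nT s Hs; rewrite ltn_neqAle low // andbT.
  by apply: contra_not_neq nT => ->.
split=> hn.
- by split=> //; apply: up => //; lia.
- split; first by apply: up; lia.
  exact/low_succ/not_irregular_order_card.
(* The bounds leave only [#|T|] and [#|T|.+1]; excluded middle selects the case without determining
   which one holds. *)
- have [HT|nT] := classic (irregular_order e #|T|); first by exists #|T|.
  by exists #|T|.+1 => //; split; [apply: up; lia | exact: low_succ].
Qed.
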